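(* Let $n\geq 3$ be an odd number. Then $\mathbf{L}_{n+1}$ and $\mathbf{L}^*_{n+1}$ are term-equivalent if and only if $n$ is a prime number belonging to the set $\Pi$.
   Context: For $n\ge 1$ let $L_{n+1}=\{0,1/n,2/n,\ldots,(n-1)/n,1\}$. The $(n+1)$-element MV-chain is $\mathbf{L}_{n+1}=(L_{n+1},\Rightarrow,\neg,0,1)$ with $x\Rightarrow y=\min\{1,1-x+y\}$ and $\neg x=1-x$. The algebra $\mathbf{L}^*_{n+1}=(L_{n+1},\vee,*,\neg,0,1)$ has the same universe and the operations $x\vee y=\max\{x,y\}$, $*x=\max\{0,2x-1\}$, $\neg x=1-x$, and the constants $0,1$. Two algebras on the same universe are term-equivalent if every basic operation of each is a term operation of the other. $\Pi$ denotes the set of odd primes $n$ such that $2^m$ is not congruent to $1$ or $-1$ modulo $n$ for every integer $m$ with $0<m<(n-1)/2$. *)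

(* Defs.v *)
From mathcomp Require Import all_boot all_order all_algebra.

Set Implicit Arguments.
Unset Strict Implicit.
Unset Printing Implicit Defensive.

Import Order.TTheory GRing.Theory Num.Theory.

Record signature := Signature { op : Type; arity : op -> nat }.

Definition algebra (S : signature) (A : Type) :=
  forall o : op S, ('I_(arity o) -> A) -> A.

Inductive term (S : signature) (k : nat) : Type :=
| Var of 'I_k
| App (o : op S) of ('I_(arity o) -> term S k).

Fixpoint eval (S : signature) (A : Type) (M : algebra S A) (k : nat)
    (v : 'I_k -> A) (t : term S k) : A :=
  match t with
  | Var i => v i
  | App o ts => M o (fun i => eval M v (ts i))
  end.

Definition term_operation (S : signature) (A : Type) (M : algebra S A)
    (k : nat) (f : ('I_k -> A) -> A) : Prop :=
  exists t : term S k, forall v : 'I_k -> A, eval M v t = f v.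

Definition term_equivalent (S1 S2 : signature) (A : Type)
    (M1 : algebra S1 A) (M2 : algebra S2 A) : Prop :=
  (forall o : op S1, term_operation M2 (M1 o)) /\
  (forall o : op S2, term_operation M1 (M2 o)).

Local Open Scope ring_scope.

(* The universe {0, 1/n, ..., (n-1)/n, 1}, as a subset of the rationals.
   It contains 1 only when n > 0, hence the hypothesis carried below. *)

Definition Lset (n : nat) : seq rat :=
  [seq k%:R / n%:R | k <- iota 0 n.+1].

Definition L (n : nat) : Type := {x : rat | x \in Lset n}.

Lemma LsetP (n : nat) (x : rat) :
  reflect (exists2 k : nat, (k <= n)%N & x = k%:R / n%:R) (x \in Lset n).
Proof.
apply: (iffP mapP) => -[k kn ->]; exists k => //; move: kn;
  by rewrite mem_iota add0n ltnS.
Qed.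

Section Closure.

Variables (n : nat) (n_gt0 : (0 < n)%N).

Let nz : (n%:R : rat) != 0.
Proof. by rewrite pnatr_eq0 -lt0n. Qed.

Let ngt0 : 0 < (n%:R : rat).
Proof. by rewrite ltr0n. Qed.

Lemma Lset0 : 0 \in Lset n.
Proof. by apply/LsetP; exists 0%N; rewrite ?mul0r. Qed.

Lemma Lset1 : 1 \in Lset n.
Proof. by apply/LsetP; exists n; rewrite ?divff. Qed.

Lemma Lset_neg x : x \in Lset n -> 1 - x \in Lset n.
Proof.
move=> /LsetP[i le_in ->]; apply/LsetP; exists (n - i)%N; first exact: leq_subr.
by rewrite natrB // mulrBl divff.
Qed.

Lemma Lset_max x y : x \in Lset n -> y \in Lset n -> Num.max x y \in Lset n.
Proof. by move=> Lx Ly; rewrite maxEle; case: ifP. Qed.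

Lemma Lset_imp x y :
  x \in Lset n -> y \in Lset n -> Num.min 1 (1 - x + y) \in Lset n.
Proof.
move=> /LsetP[i le_in ->] /LsetP[j le_jn ->].
have -> : 1 - i%:R / n%:R + j%:R / n%:R = (n - i + j)%N%:R / n%:R :> rat.
  by rewrite natrD natrB // mulrDl mulrBl divff.
rewrite minEle; case: leP => [_|lt1]; first exact: Lset1.
apply/LsetP; exists (n - i + j)%N => //.
by move: lt1; rewrite ltr_pdivrMr // mul1r ltr_nat => /ltnW.
Qed.

Lemma Lset_star x : x \in Lset n -> Num.max 0 (2 * x - 1) \in Lset n.
Proof.
move=> /LsetP[i le_in ->].
have -> : 2 * (i%:R / n%:R) - 1 = ((2 * i)%N%:R - n%:R) / n%:R :> rat.
  by rewrite natrM mulrBl divff // mulrA.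
rewrite maxEle; case: leP => [ge0|_]; last exact: Lset0.
have le_n2i : (n <= 2 * i)%N.
  by move: ge0; rewrite pmulr_lge0 ?invr_gt0 // subr_ge0 ler_nat.
apply/LsetP; exists (2 * i - n)%N; last by rewrite natrB.
by rewrite leq_subLR mul2n -addnn leq_add.
Qed.

Definition L_zero : L n := exist _ 0 Lset0.
Definition L_one : L n := exist _ 1 Lset1.
Definition L_neg (x : L n) : L n := exist _ (1 - val x) (Lset_neg (valP x)).
Definition L_imp (x y : L n) : L n :=
  exist _ (Num.min 1 (1 - val x + val y)) (Lset_imp (valP x) (valP y)).
Definition L_join (x y : L n) : L n :=
  exist _ (Num.max (val x) (val y)) (Lset_max (valP x) (valP y)).
Definition L_star (x : L n) : L n :=
  exist _ (Num.max 0 (2 * val x - 1)) (Lset_star (valP x)).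

End Closure.

Inductive mv_op := MVimp | MVneg | MVzero | MVone.

Definition mv_sig : signature := Signature (fun o : mv_op =>
  match o with MVimp => 2%N | MVneg => 1%N | MVzero | MVone => 0%N end).

Definition MVchain (n : nat) (n_gt0 : (0 < n)%N) : algebra mv_sig (L n) :=
  fun o => match o return ('I_(@arity mv_sig o) -> L n) -> L n with
  | MVimp => fun a => L_imp n_gt0 (a ord0) (a ord_max)
  | MVneg => fun a => L_neg n_gt0 (a ord0)
  | MVzero => fun _ => L_zero n
  | MVone => fun _ => L_one n_gt0
  end.

Inductive star_op := STjoin | STstar | STneg | STzero | STone.

Definition star_sig : signature := Signature (fun o : star_op =>
  match o with
  | STjoin => 2%N | STstar | STneg => 1%N | STzero | STone => 0%N
  end).

Definition starchain (n : nat) (n_gt0 : (0 < n)%N) : algebra star_sig (L n) :=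
  fun o => match o return ('I_(@arity star_sig o) -> L n) -> L n with
  | STjoin => fun a => L_join (a ord0) (a ord_max)
  | STstar => fun a => L_star n_gt0 (a ord0)
  | STneg => fun a => L_neg n_gt0 (a ord0)
  | STzero => fun _ => L_zero n
  | STone => fun _ => L_one n_gt0
  end.

(* For odd n, n.-1./2 is exactly (n - 1) / 2. *)
Definition in_Pi (n : nat) : Prop :=
  [/\ odd n, prime n &
      forall m : nat, (0 < m < n.-1./2)%N ->
        (2 ^+ m != 1 %[mod n%:Z])%Z /\ (2 ^+ m != -1 %[mod n%:Z])%Z].

(* Main.v *)
Require Import Defs.
From mathcomp Require Import all_boot all_order all_algebra.
From mathcomp Require Import zify.

Set Implicit Arguments.
Unset Strict Implicit.
Unset Printing Implicit Defensive.

Import Order.TTheory GRing.Theory Num.Theory.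

(** Both algebras are studied through numerators: the element k/n is coded by
    the natural number k, so that star becomes the truncated 2k - n, negation
    n - k, and join the maximum.

    The bridge between algebra and arithmetic is that, modulo n, star and
    negation only multiply by 2 and by -1.  Both sides of the equivalence are
    compared with a third condition: every residue of 1, ..., n-1 is, up to
    sign, a power of two modulo n.  As n is odd, this makes all of these
    residues units, so n is prime.  There are n-1 expressions (-1)^s 2^j with
    j < (n-1)/2, and they are pairwise distinct modulo n exactly when no 2^m
    with 0 < m < (n-1)/2 is 1 or -1; counting then gives the arithmetic half,
    [prime_PiP].

    Suppose implication is a term operation of the star chain.  The elements
    whose numerator is 0, or up to sign a power of two, modulo n, form a
    subalgebra of the star chain ([star_eval_signed_pow2]), so they are closed
    under implication.  They contain (n-1)/n, and (n-1)/n => k/n is (k+1)/n,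
    hence they are the whole chain ([signed_pow2_of_imp]).

    Conversely, the join of star x and star (not x) has numerator |2k - n|,
    which is 2k up to sign modulo n.  If every nonzero residue is a signed power of two, then
    iterating this term, and negating once if necessary, carries any k with
    0 < k < n to any prescribed c with 0 < c < n
    ([interior_generates_of_signed_pow2]).  On the other hand the star chain
    always separates two distinct points by a two-valued term, because star
    doubles distances on the upper half of the chain and distances are at most
    n ([separation]).  Indicators of points are therefore definable, and gluing
    them together shows that every function preserving {0, 1} is a term
    operation ([definable_interpolation]); implication is one.  That star and
    join are terms in implication and negation holds for every n. *)

(** * Signed powers of two modulo an odd number *)

Section SignedPowersOfTwo.
Variables (n : nat) (n_gt1 : (1 < n)%N) (n_odd : odd n).
Local Open Scope ring_scope.

Definition signed_pow2 (x : 'Z_n) : Prop :=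
  exists s m : nat, x = (-1) ^+ s * 2 ^+ m.

Lemma Zp_nat_eq0 k : ((k%:R : 'Z_n) == 0) = (n %| k)%N.
Proof. by rewrite -val_eqE /= val_Zp_nat. Qed.

Lemma Zp_n : n%:R = 0 :> 'Z_n.
Proof. by apply/eqP; rewrite Zp_nat_eq0. Qed.

Lemma Zp_int_eq0 z : ((z%:~R : 'Z_n) == 0) = (n%:Z %| z)%Z.
Proof.
rewrite dvdzE absz_nat -Zp_nat_eq0; case: z => k //=.
by rewrite NegzE mulrNz oppr_eq0.
Qed.

Lemma Zp_int_eq y z : ((y%:~R : 'Z_n) == z%:~R) = (y == z %[mod n%:Z])%Z.
Proof. by rewrite eqz_mod_dvd -Zp_int_eq0 rmorphB subr_eq0. Qed.

Lemma unit2 : (2 : 'Z_n) \is a GRing.unit.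
Proof. by rewrite unitZpE // coprimen2. Qed.

Lemma unit_signed_pow2 x : signed_pow2 x -> x \is a GRing.unit.
Proof. by move=> [s [m ->]]; rewrite unitrM !unitrX ?unitrN1 ?unit2. Qed.

(** A proper divisor of n greater than 1 would be a unit modulo n. *)
Lemma prime_of_signed_pow2 :
  (forall k, (0 < k < n)%N -> signed_pow2 k%:R) -> prime n.
Proof.
move=> gen; apply: contraT => /primePn[|[d /andP[d_gt1 dn] d_dvd]]; first by lia.
have := unit_signed_pow2 (gen d _); rewrite unitZpE // /coprime gcdnC.
by move/gcdn_idPl: d_dvd => -> /(_ _)/eqP; lia.
Qed.

(** Turns the integer congruences defining Pi into a statement in 'Z_n; the sign
    is written (-1)^s for an arbitrary s so that exponents can be added freely. *)
Lemma Zp_pow2_sign m :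
  ((2 ^+ m != 1 %[mod n%:Z])%Z /\ (2 ^+ m != -1 %[mod n%:Z])%Z)
  <-> forall s : nat, 2 ^+ m != (-1) ^+ s :> 'Z_n.
Proof.
rewrite -!Zp_int_eq !rmorphXn /= rmorphN rmorph1 /=.
split=> [[ne1 neN1] s|ne]; last by split; [apply: (ne 0%N) | apply: (ne 1%N)].
by rewrite -signr_odd; case: odd; rewrite ?expr1 ?expr0.
Qed.

Let signed_pow2_of m (u : 'I_m * bool) : 'Z_n := (-1) ^+ u.2 * 2 ^+ u.1.

Lemma card_nonzero_Zp : #|[set~ 0 : 'Z_n]| = n.-1.
Proof. by rewrite cardsC1 card_ord Zp_cast. Qed.

(** Under the Pi condition the pairs (j, s) with j < (n-1)/2 give n-1 distinct
    units (-1)^s 2^j, which leaves no nonzero residue uncovered. *)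
Lemma signed_pow2_of_Pi :
  in_Pi n -> forall x : 'Z_n, x != 0 -> signed_pow2 x.
Proof.
move=> [_ _ Pi]; pose h := n.-1./2.
(* Dividing a coincidence by 2^i would give 2^(j-i) = 1 or -1. *)
have lt_false i j s t : (i < j < h)%N ->
    (-1) ^+ s * 2 ^+ i = (-1) ^+ t * 2 ^+ j :> 'Z_n -> False.
  move=> /andP[ij jh] E.
  have ji : (0 < j - i < n.-1./2)%N by move: jh; rewrite /h; lia.
  have /Zp_pow2_sign/(_ (s + t)%N)/eqP[] := Pi _ ji.
  apply: (mulIr (unitrX i unit2)); rewrite -exprD subnK 1?ltnW //.
  rewrite addnC exprD -mulrA E mulrA -exprD addnn -mul2n exprM sqrrN.
  by rewrite !expr1n mul1r.
have inj : injective (@signed_pow2_of h).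
  move=> [i s] [j t]; rewrite /signed_pow2_of /= => E.
  have Eij : i = j.
    apply: val_inj => /=; case: (ssrnat.ltngtP i j) => // [ij|ji].
      by case: (lt_false _ _ _ _ _ E); rewrite ij ltn_ord.
    by case: (lt_false _ _ _ _ _ (esym E)); rewrite ji ltn_ord.
  rewrite Eij in E *; move/(mulIr (unitrX j unit2)): E.
  have ne : (1 != -1 :> 'Z_n).
    rewrite -subr_eq0 opprK; apply/eqP => E; have := unit2.
    by rewrite [2](_ : _ = 0) // unitr0.
  by case: s t => [] [] // /eqP; rewrite ?[-1 == _]eq_sym (negPf ne).
have full : [set signed_pow2_of u | u in {: 'I_h * bool}] = [set~ 0].
  apply/eqP; rewrite eqEcard; apply/andP; split.
    apply/subsetP => _ /imsetP[[i s] _ ->]; rewrite !inE.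
    have : signed_pow2_of (i, s) \is a GRing.unit.
      by apply: unit_signed_pow2; exists s, i.
    by apply: contraTneq => ->; rewrite unitr0.
  rewrite card_imset // card_nonzero_Zp card_prod card_ord card_bool /h.
  by lia.
move=> x; rewrite -in_setC1 -full => /imsetP[[i s] _ ->].
by exists s, i.
Qed.

(** If 2^m is 1 or -1 then exponents may be reduced modulo m, so there are at
    most 2m signed powers of two, and 2m < n-1. *)
Lemma Pi_of_signed_pow2 :
  (forall x : 'Z_n, x != 0 -> signed_pow2 x) ->
  forall m, (0 < m < n.-1./2)%N ->
  (2 ^+ m != 1 %[mod n%:Z])%Z /\ (2 ^+ m != -1 %[mod n%:Z])%Z.
Proof.
move=> gen m /andP[m_gt0 m_lt]; apply/Zp_pow2_sign => e; apply/eqP => E.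
suff : leq #|[set~ 0 : 'Z_n]| (m * 2)%N by rewrite card_nonzero_Zp; lia.
rewrite -[m]card_ord -card_bool -card_prod.
apply: leq_trans (leq_imset_card (@signed_pow2_of m) _).
apply/subset_leq_card/subsetP => x; rewrite !inE => /gen[s [l ->]].
apply/imsetP; exists (Ordinal (ltn_pmod l m_gt0), odd (s + e * (l %/ m))) => //.
rewrite /signed_pow2_of /= signr_odd {1}(divn_eq l m) [in LHS]exprD.
by rewrite mulnC [2 ^+ (m * _)]exprM E -exprM mulrA -exprD.
Qed.

Lemma signed_pow2_nonzero :
  (forall k, (0 < k < n)%N -> signed_pow2 k%:R) ->
  forall x : 'Z_n, x != 0 -> signed_pow2 x.
Proof.
move=> gen x x_neq0; rewrite -[x]natr_Zp; apply: gen.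
by rewrite lt0n x_neq0 -[X in (_ < X)%N](Zp_cast n_gt1) ltn_ord.
Qed.

Lemma prime_PiP :
  prime n /\ in_Pi n <-> forall k, (0 < k < n)%N -> signed_pow2 k%:R.
Proof.
split=> [[_ Pi] k /andP[k_gt0 kn]|gen].
  by apply: signed_pow2_of_Pi => //; rewrite Zp_nat_eq0 gtnNdvd.
have n_pr := prime_of_signed_pow2 gen; split=> //; split=> //.
exact: Pi_of_signed_pow2 (signed_pow2_nonzero gen).
Qed.

End SignedPowersOfTwo.

(** * Numerators *)

Section Numerator.

Variables (n : nat) (n_gt0 : (0 < n)%N).

Definition num (x : L n) : nat := index (val x) (Lset n).

Lemma size_Lset : size (Lset n) = n.+1.
Proof. by rewrite size_map size_iota. Qed.

Lemma num_le x : (num x <= n)%N.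
Proof. by rewrite -ltnS -size_Lset index_mem (valP x). Qed.

Lemma val_num x : (val x = (num x)%:R / n%:R)%R.
Proof.
rewrite -[LHS](nth_index 0%R (valP x)) -/(num x).
by rewrite (nth_map 0%N) ?size_iota ?ltnS ?num_le // nth_iota ?ltnS ?num_le.
Qed.

Lemma num_inj : injective num.
Proof. by move=> x y Exy; apply: val_inj; rewrite /= !val_num Exy. Qed.

Lemma num_eq (x : L n) (k : nat) : (val x = k%:R / n%:R)%R -> num x = k.
Proof.
have nz : (n%:R != 0 :> rat)%R by rewrite pnatr_eq0 -lt0n.
rewrite val_num => /(mulIf (invr_neq0 nz))/eqP.
by rewrite eqr_nat => /eqP.
Qed.

Definition point (k : nat) : L n := insubd (L_zero n) (k%:R / n%:R)%R.

Lemma num_point k : (k <= n)%N -> num (point k) = k.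
Proof. by move=> kn; apply: num_eq; rewrite insubdK //; apply/LsetP; exists k. Qed.

Lemma point_num x : point (num x) = x.
Proof. by apply: num_inj; rewrite num_point ?num_le. Qed.

Let nz : (n%:R != 0 :> rat)%R.
Proof. by rewrite pnatr_eq0 -lt0n. Qed.

Let npos : (0 < n%:R :> rat)%R.
Proof. by rewrite ltr0n. Qed.

Lemma num_zero : num (L_zero n) = 0%N.
Proof. by apply: num_eq; rewrite mul0r. Qed.

Lemma num_one : num (L_one n_gt0) = n.
Proof. by apply: num_eq; rewrite divff. Qed.

Lemma num_neg x : num (L_neg n_gt0 x) = (n - num x)%N.
Proof.
by apply: num_eq; rewrite /= [sval x]val_num natrB ?num_le // mulrBl divff.
Qed.

Lemma num_join x y : num (L_join x y) = maxn (num x) (num y).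
Proof.
apply: num_eq; rewrite /= [sval x]val_num [sval y]val_num.
rewrite maxEle ler_pM2r ?invr_gt0 // ler_nat.
by rewrite /maxn; case: ltngtP => // [->].
Qed.

Lemma num_star x : num (L_star n_gt0 x) = (2 * num x - n)%N.
Proof.
apply: num_eq; rewrite /= [sval x]val_num.
have -> : (2 * ((num x)%:R / n%:R) - 1 = ((2 * num x)%N%:R - n%:R) / n%:R :> rat)%R.
  by rewrite natrM mulrBl divff // mulrA.
rewrite maxEle pmulr_lge0 ?invr_gt0 // subr_ge0 ler_nat.
case: leqP => [le|/ltnW]; first by rewrite natrB.
by rewrite -subn_eq0 => /eqP ->; rewrite mul0r.
Qed.

Lemma num_imp x y : num (L_imp n_gt0 x y) = minn n (n - num x + num y).
Proof.
apply: num_eq; rewrite /= [sval x]val_num [sval y]val_num.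
have -> : (1 - (num x)%:R / n%:R + (num y)%:R / n%:R
           = (n - num x + num y)%N%:R / n%:R :> rat)%R.
  by rewrite natrD natrB ?num_le // mulrDl mulrBl divff.
rewrite minEle ler_pdivlMr // mul1r ler_nat.
by case: leqP => _ //; rewrite divff.
Qed.

(** * Term operations of the star chain *)

Local Notation M := (starchain n_gt0).

(** Term operations, with their values read as numerators: this makes the
    operations of the chain plain arithmetic on natural numbers. *)
Definition definable k (f : ('I_k -> L n) -> nat) : Prop :=
  exists t : term star_sig k, forall v, num (eval M v t) = f v.

Lemma definable_ext k (f g : ('I_k -> L n) -> nat) :
  f =1 g -> definable f -> definable g.
Proof. by move=> fg [t tf]; exists t => v; rewrite tf. Qed.

Lemma definable_term k (f : ('I_k -> L n) -> L n) :
  definable (fun v => num (f v)) <-> term_operation M f.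
Proof.
by split=> -[t tf]; exists t => v; [apply: num_inj | congr num]; apply: tf.
Qed.

Lemma definable_var k (i : 'I_k) : definable (fun v => num (v i)).
Proof. by exists (Var _ i). Qed.

Lemma definable0 k : definable (fun _ : 'I_k -> L n => 0%N).
Proof.
(* STzero has no arguments: 'I_0 is empty. *)
exists (@App star_sig k STzero (fun i => False_rect _ (notF (ltn_ord i)))).
by move=> v; rewrite /= num_zero.
Qed.

Lemma definable_neg k (f : ('I_k -> L n) -> nat) :
  definable f -> definable (fun v => n - f v)%N.
Proof.
move=> [t tf]; exists (@App star_sig k STneg (fun=> t)) => v.
by rewrite /= num_neg tf.
Qed.

Lemma definable_star k (f : ('I_k -> L n) -> nat) :
  definable f -> definable (fun v => 2 * f v - n)%N.
Proof.
move=> [t tf]; exists (@App star_sig k STstar (fun=> t)) => v.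
by rewrite /= num_star tf.
Qed.

Lemma definable_join k (f g : ('I_k -> L n) -> nat) :
  definable f -> definable g -> definable (fun v => maxn (f v) (g v)).
Proof.
move=> [t tf] [u ug].
exists (@App star_sig k STjoin (fun i => if i == ord0 then t else u)) => v.
by rewrite /= num_join tf ug.
Qed.

Lemma definable_le k (f : ('I_k -> L n) -> nat) v : definable f -> (f v <= n)%N.
Proof. by move=> [t <-]; apply: num_le. Qed.

Lemma definable_meet k (f g : ('I_k -> L n) -> nat) :
  definable f -> definable g -> definable (fun v => minn (f v) (g v)).
Proof.
move=> df dg.
apply: definable_ext
  (definable_neg (definable_join (definable_neg df) (definable_neg dg))) => v.
by have := definable_le v df; have := definable_le v dg; lia.
Qed.

(** Closure under composition is taken as the definition of a unary term
    operation, which avoids substitution in terms. *)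
Definition unary_definable (h : nat -> nat) : Prop :=
  forall k (f : ('I_k -> L n) -> nat), definable f -> definable (h \o f).

Lemma unary_comp g h :
  unary_definable g -> unary_definable h -> unary_definable (g \o h).
Proof. by move=> dg dh k f /dh/dg. Qed.

Lemma unary_iter m h : unary_definable h -> unary_definable (iter m h).
Proof. by move=> dh; elim: m => [|m IH] // k f /IH/dh. Qed.

Lemma unary_neg : unary_definable (subn n).
Proof. by move=> k f; apply: definable_neg. Qed.

Lemma unary_star : unary_definable (fun x => 2 * x - n)%N.
Proof. by move=> k f; apply: definable_star. Qed.

Lemma unary_ext g h :
  (forall x, (x <= n)%N -> g x = h x) -> unary_definable g -> unary_definable h.
Proof.
move=> gh dg k f df; apply: definable_ext (dg _ _ df) => v /=.
by apply: gh; apply: definable_le.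
Qed.

(** Star doubles the distance to the top, so n iterations, with 2^n >= n, send
    every element other than the top to the bottom. *)
Lemma unary_is_one : unary_definable (fun x => if x == n then n else 0%N).
Proof.
have iter_star m x : (x <= n)%N ->
    iter m (fun x => 2 * x - n)%N x = (n - 2 ^ m * (n - x))%N.
  by move=> xn; elim: m => [|m IH] /=; rewrite ?IH ?expnS -?mulnA; lia.
apply: unary_ext (unary_iter n unary_star) => x xn.
rewrite iter_star //; case: eqP => [->|/eqP x_neq_n]; first by lia.
have : (n <= 2 ^ n)%N by apply: ltnW; apply: ltn_expl.
by nia.
Qed.

Lemma unary_nonzero : unary_definable (fun x => if x == 0%N then 0%N else n).
Proof.
apply: unary_ext (unary_comp unary_neg (unary_comp unary_is_one unary_neg)).
by move=> x xn /=; case: ifP; case: ifP; lia.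
Qed.

(** Asking for values in {0, n} only makes the separating map complementable,
    whence the symmetry in a and b. *)
Definition separated a b : Prop :=
  exists h, [/\ unary_definable h, h a = n, h b = 0%N
              & forall x, (x <= n)%N -> h x = 0%N \/ h x = n].

Lemma separated_sym a b : separated a b -> separated b a.
Proof.
move=> [h [dh ha hb h01]]; exists (subn n \o h); split=> /=.
- exact: unary_comp unary_neg dh.
- by rewrite hb subn0.
- by rewrite ha subnn.
- by move=> x /h01[] ->; rewrite ?subnn ?subn0; auto.
Qed.

Lemma separated_comp g a b : unary_definable g ->
  (forall x, (x <= n)%N -> (g x <= n)%N) -> separated (g a) (g b) -> separated a b.
Proof.
move=> dg gn [h [dh ha hb h01]]; exists (h \o g); split=> //.
- exact: unary_comp dh dg.
- by move=> x /gn/h01.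
Qed.

(** If the midpoint lies between b and a, star kills b and not a.  Otherwise
    both are on the same side, and star, preceded by negation if that side is the
    lower one, doubles their distance.  The bound m on the number of doublings
    counts how far the distance is from n, its largest possible value. *)
Lemma separated_lt m a b :
  (b < a <= n)%N -> (n <= m + (a - b))%N -> separated a b.
Proof.
elim: m a b => [|m IH] a b /andP[ba an] dist.
  have [-> ->] : a = n /\ b = 0%N by lia.
  exists (fun x => if x == n then n else 0%N); split.
  - exact: unary_is_one.
  - by rewrite eqxx.
  - by case: eqP => //; lia.
  - by move=> x _; case: ifP; auto.
have [le_a|lt_a] := leqP (2 * a) n.
  apply/separated_sym/(@separated_comp (fun x => 2 * (n - x) - n)%N); last first.
  - by apply: IH; lia.
  - by move=> x xn; lia.
  - exact: unary_comp unary_star unary_neg.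
have [lt_b|le_b] := ltnP n (2 * b).
  apply: (@separated_comp (fun x => 2 * x - n)%N); last by apply: IH; lia.
  - exact: unary_star.
  - by move=> x xn; lia.
exists (fun x => if 2 * x - n == 0 then 0 else n)%N; split.
- exact: unary_comp unary_nonzero unary_star.
- by case: eqP => //; lia.
- by case: eqP => //; lia.
- by move=> x _; case: ifP; auto.
Qed.

Lemma separation a b : (a <= n)%N -> (b <= n)%N -> a != b -> separated a b.
Proof.
move=> an bn; rewrite neq_ltn => /orP[ab|ba].
  by apply: separated_sym; apply: (@separated_lt n); lia.
by apply: (@separated_lt n); lia.
Qed.

Definition interior_generates : Prop :=
  forall a c, (0 < a < n)%N -> (c <= n)%N ->
    exists h, unary_definable h /\ h a = c.

Lemma definable_eq k (f : ('I_k -> L n) -> nat) v w :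
  definable f -> v =1 w -> f v = f w.
Proof.
move=> [t tf] vw; rewrite -!tf; congr num.
by elim: t {tf} => [i|[] ts IH] //=; rewrite ?IH ?vw.
Qed.

(** Enumerates the points of the k-th power of the chain, up to pointwise
    equality, by a finite type. *)
Definition grid_point k (p : {ffun 'I_k -> 'I_n.+1}) : 'I_k -> L n :=
  fun i => point (p i).

Lemma grid_pointP k (v : 'I_k -> L n) : exists p, v =1 grid_point p.
Proof.
exists [ffun i => inord (num (v i))] => i.
by rewrite /grid_point ffunE inordK ?ltnS ?num_le // point_num.
Qed.

Lemma definable_one k : definable (fun _ : 'I_k -> L n => n).
Proof.
by apply: definable_ext (definable_neg (definable0 k)) => v; rewrite subn0.
Qed.

(** Obtained as the meet, over the finitely many points q other than p, of
    maps separating a coordinate of p from the same coordinate of q. *)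
Lemma definable_indicator k (p : 'I_k -> L n) :
  exists f, [/\ definable f, f p = n & forall v, f v = 0%N \/ v =1 p].
Proof.
suff [f [df fp fq]] : exists f, [/\ definable f, f p = n & forall q,
    q \in enum {: {ffun 'I_k -> 'I_n.+1}} ->
    f (grid_point q) = 0%N \/ grid_point q =1 p].
  exists f; split=> // v; have [q vq] := grid_pointP v.
  rewrite (definable_eq df vq); have [||qp] := fq q; rewrite ?mem_enum; auto.
  by right=> i; rewrite vq qp.
elim: (enum _) => [|q s [f [df fp fs]]].
  by exists (fun=> n); split=> //; apply: definable_one.
have [/forallP Eqp|] := boolP [forall i, num (grid_point q i) == num (p i)].
  exists f; split=> // u; rewrite inE => /orP[/eqP->|/fs //]; right=> i.
  by apply/num_inj/eqP.
rewrite negb_forall => /existsP[i]; rewrite eq_sym => neq.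
have [h [dh hp hq _]] := separation (num_le (p i)) (num_le (grid_point q i)) neq.
exists (fun v => minn (f v) (h (num (v i)))); split.
- by apply: definable_meet => //; apply: dh; apply: definable_var.
- by rewrite fp hp minnn.
- move=> u; rewrite inE => /orP[/eqP->|/fs[->|]]; [left|left|by right].
    by rewrite hq minn0.
  by rewrite min0n.
Qed.

(** The function f is the join over all points p of the meet of the indicator
    of p with a term taking the value f p at p.  Such a term is obtained from an
    interior coordinate of p; when p has none, f p is a constant of the
    signature. *)
Lemma definable_interpolation k (f : ('I_k -> L n) -> nat) :
  interior_generates ->
  (forall v w, v =1 w -> f v = f w) ->
  (forall v, (f v <= n)%N) ->
  (forall v, (forall i, num (v i) = 0%N \/ num (v i) = n) ->
     f v = 0%N \/ f v = n) ->
  definable f.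
Proof.
move=> gen f_ext f_le f01.
have f_at p : exists g, definable g /\ g p = f p.
  have [/existsP[i /andP[i0 iN]]|] :=
    boolP [exists i, (num (p i) != 0%N) && (num (p i) != n)].
    have [||h [dh hp]] := gen (num (p i)) (f p) _ _ => //.
      by have := num_le (p i); lia.
    by exists (fun v => h (num (v i))); split=> //; apply: dh (definable_var i).
  rewrite negb_exists => /forallP p01.
  have [i|fp|fp] := f01 p.
  - by have := p01 i; rewrite negb_and !negbK => /orP[]/eqP; auto.
  - by exists (fun=> 0%N); split=> //; apply: definable0.
  - by exists (fun=> n); split=> //; apply: definable_one.
(* The peaks lie below f, hence so do their joins. *)
have {f_at} f_peak p : exists g,
    [/\ definable g, g p = f p & forall v, (g v <= f v)%N].
  have [g [dg gp]] := f_at p; have [h [dh hp h0]] := definable_indicator p.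
  exists (fun v => minn (h v) (g v)); split.
  - exact: definable_meet.
  - by rewrite hp gp; have := f_le p; lia.
  - move=> v; have [->|vp] := h0 v; first by rewrite min0n.
    by rewrite (f_ext _ _ vp) -gp (definable_eq dg vp) geq_minr.
suff [g [dg gf gs]] : exists g, [/\ definable g, forall v, (g v <= f v)%N & forall q,
    q \in enum {: {ffun 'I_k -> 'I_n.+1}} -> g (grid_point q) = f (grid_point q)].
  apply: (definable_ext _ dg) => v; have [q vq] := grid_pointP v.
  by rewrite (f_ext _ _ vq) (definable_eq dg vq) gs ?mem_enum.
elim: (enum _) => [|q s [g [dg gf gs]]].
  by exists (fun=> 0%N); split=> //; apply: definable0.
have [h [dh hq hf]] := f_peak (grid_point q).
exists (fun v => maxn (g v) (h v)); split.
- exact: definable_join.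
- by move=> v; rewrite geq_max gf hf.
- move=> r; rewrite inE => /orP[/eqP->|/gs gr].
    by rewrite hq; apply/maxn_idPr; apply: gf.
  by rewrite gr; apply/maxn_idPl; apply: hf.
Qed.

End Numerator.

(** * Subalgebras of the star chain and signed powers of two *)

Section Generation.

Variables (n : nat) (n_gt1 : (1 < n)%N) (n_gt0 : (0 < n)%N).
Local Open Scope ring_scope.

Definition zero_or_signed_pow2 (x : 'Z_n) : Prop := x = 0 \/ signed_pow2 x.

Lemma zero_or_signed_pow2N x : zero_or_signed_pow2 x -> zero_or_signed_pow2 (- x).
Proof.
move=> [->|[s [m ->]]]; first by left; rewrite oppr0.
by right; exists s.+1, m; rewrite exprS mulN1r mulNr.
Qed.

Lemma zero_or_signed_pow2M x : zero_or_signed_pow2 x -> zero_or_signed_pow2 (2 * x).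
Proof.
move=> [->|[s [m ->]]]; first by left; rewrite mulr0.
by right; exists s, m.+1; rewrite exprS mulrCA.
Qed.

(** Modulo n, star either doubles the numerator or gives 0, negation changes
    its sign, and join returns one of its arguments. *)
Lemma star_eval_signed_pow2 k (v : 'I_k -> L n) (t : term star_sig k) :
  (forall i, zero_or_signed_pow2 ((num (v i))%:R : 'Z_n)) ->
  zero_or_signed_pow2 ((num (eval (starchain n_gt0) v t))%:R : 'Z_n).
Proof.
move=> vS; elim: t => [i|[] ts IH] //=.
- by rewrite num_join //; case: ssrnat.leqP.
- rewrite num_star; have [le|lt] := leqP n (2 * num (eval (starchain n_gt0) v (ts ord0))).
    by rewrite natrB // (Zp_n n_gt1) subr0 natrM; apply: zero_or_signed_pow2M.
  by move/ltnW: lt; rewrite -subn_eq0 => /eqP->; left.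
- rewrite num_neg natrB ?num_le // (Zp_n n_gt1) sub0r.
  exact: zero_or_signed_pow2N.
- by rewrite num_zero //; left.
- by rewrite num_one (Zp_n n_gt1); left.
Qed.

Lemma signed_pow2_of_imp :
  term_operation (starchain n_gt0) (@MVchain n n_gt0 MVimp) ->
  forall k, (0 < k < n)%N -> signed_pow2 (k%:R : 'Z_n).
Proof.
move=> [t tE] k /andP[k_gt0 kn].
(* Induction on k: (n-1) => k is k+1, and n-1 is -1 modulo n. *)
suff [|//] : zero_or_signed_pow2 (k%:R : 'Z_n).
  by move/eqP; rewrite (Zp_nat_eq0 n_gt1) gtnNdvd.
have {k_gt0} : (k <= n)%N by exact: ltnW.
elim: k {kn} => [|k IH] kn; first by left.
pose v (i : 'I_2) : L n := if i == ord0 then point n n.-1 else point n k.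
have := @star_eval_signed_pow2 _ v t; rewrite tE /= num_imp /v /=.
rewrite !num_point; try lia.
have -> : minn n (n - n.-1 + k) = k.+1 by lia.
apply=> i; case: ifP => _; rewrite num_point; try lia.
  have -> : n.-1 = (n - 1)%N by lia.
  rewrite natrB // (Zp_n n_gt1) sub0r; right; exists 1%N, 0%N.
  by rewrite mulr1.
by apply: IH; lia.
Qed.

Hypothesis n_odd : odd n.

(** With c/a equal to 2^m up to sign modulo n, the m-th iterate of |2x - n| at
    a is c or n - c. *)
Lemma interior_generates_of_signed_pow2 :
  (forall k, (0 < k < n)%N -> signed_pow2 (k%:R : 'Z_n)) -> interior_generates n_gt0.
Proof.
move=> gen a c a_int cn.
have [c_bd|c_int] : (c = 0%N \/ c = n) \/ (0 < c < n)%N by lia.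
  exists (fun=> c); split=> // k f _.
  by case: c_bd => ->; [apply: definable0 | apply: definable_one].
(* D x is |2x - n|; as n is odd, it stays strictly between 0 and n. *)
pose D x := maxn (2 * x - n) (2 * (n - x) - n).
have D_def : unary_definable n_gt0 D.
  move=> k f df; apply: definable_join; first exact: definable_star.
  exact/definable_star/definable_neg.
have D_Zp m : (0 < iter m D a < n)%N /\
    exists s : nat, (iter m D a)%:R = (-1) ^+ s * 2 ^+ m * a%:R :> 'Z_n.
  elim: m => [|m [d_int [s ds]]] /=.
    by split=> //; exists 0%N; rewrite mulr1 mul1r.
  move: (iter m D a) d_int ds => d d_int ds; rewrite /D; split; first by lia.
  have [lt|le] := ltnP n (2 * d).
    have -> : maxn (2 * d - n) (2 * (n - d) - n) = (2 * d - n)%N by lia.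
    exists s; rewrite natrB 1?ltnW // (Zp_n n_gt1) subr0 natrM ds.
    by rewrite exprS !mulrA [_ * 2]mulrC.
  have -> : maxn (2 * d - n) (2 * (n - d) - n) = (n - 2 * d)%N by lia.
  exists s.+1; rewrite natrB // (Zp_n n_gt1) sub0r natrM ds.
  by rewrite !exprS !mulN1r !mulNr !mulrA [_ * 2]mulrC.
have a_unit := unit_signed_pow2 n_gt1 n_odd (gen a a_int).
have c_unit := unit_signed_pow2 n_gt1 n_odd (gen c c_int).
have [t [m ca]] : signed_pow2 (c%:R / a%:R : 'Z_n).
  apply: (signed_pow2_nonzero n_gt1) => //.
  have : (c%:R / a%:R : 'Z_n) \is a GRing.unit by rewrite unitrM unitrV c_unit.
  by apply: contraTneq => ->; rewrite unitr0.
have [d_int [s ds]] := D_Zp m.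
have cd : c%:R = (-1) ^+ (s + t) * (iter m D a)%:R :> 'Z_n.
  rewrite ds !mulrA -exprD addnC addnA addnn -mul2n addnC exprD exprM sqrrN.
  rewrite !expr1n mulr1 -ca.
  by rewrite divrK.
move: cd; rewrite -signr_odd; case: odd; rewrite ?mul1r ?mulN1r => cd.
  exists (subn n \o iter m D); split.
    apply: unary_comp (unary_iter m D_def); apply: unary_neg.
  have /eqP : c%:R + (iter m D a)%:R = 0 :> 'Z_n by rewrite cd addNr.
  by rewrite -natrD (Zp_nat_eq0 n_gt1) /= => /dvdnP[[|[|q]]]; nia.
exists (iter m D); split; first exact: unary_iter.
have := congr1 val cd; rewrite /= !val_Zp_nat // !modn_small //; lia.
Qed.

End Generation.

(** * Term equivalence *)

Section Definitions.
Variables (n : nat) (n_gt0 : (0 < n)%N).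

(** The Lukasiewicz operations map {0, 1} into itself, so interpolation
    applies. *)
Lemma MV_definable :
  interior_generates n_gt0 ->
  forall o, term_operation (starchain n_gt0) (@MVchain n n_gt0 o).
Proof.
move=> gen o; apply/definable_term; apply: definable_interpolation => //.
- by case: o => v w vw /=; rewrite ?vw.
- by move=> v; apply: num_le.
- case: o => v v01 /=.
  + by rewrite num_imp; have := v01 ord0; have := v01 ord_max; lia.
  + by rewrite num_neg; have := v01 ord0; lia.
  + by rewrite num_zero //; left.
  + by rewrite num_one; right.
Qed.

(** The join of x and y is (x => y) => y, and star x is not (x => not x). *)
Lemma star_definable o : term_operation (MVchain n_gt0) (@starchain n n_gt0 o).
Proof.
pose imp k (t u : term mv_sig k) : term mv_sig k :=
  @App mv_sig k MVimp (fun i => if i == ord0 then t else u).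
pose neg k (t : term mv_sig k) : term mv_sig k := @App mv_sig k MVneg (fun=> t).
case: o.
- exists (imp _ (imp _ (Var _ ord0) (Var _ ord_max)) (Var _ ord_max)) => v.
  apply: num_inj; rewrite /= !num_imp num_join //.
  by have := num_le (v ord0); have := num_le (v ord_max); lia.
- exists (neg _ (imp _ (Var _ ord0) (neg _ (Var _ ord0)))) => v.
  apply: num_inj; rewrite /= !(num_imp, num_neg) num_star.
  by have := num_le (v ord0); lia.
- by exists (neg _ (Var _ ord0)).
- by exists (@App mv_sig _ MVzero (fun i => Var _ i)).
- by exists (@App mv_sig _ MVone (fun i => Var _ i)).
Qed.

End Definitions.

Theorem theorem3p19 (n : nat) (n_ge3 : (3 <= n)%N) (n_odd : odd n) :
  term_equivalent (MVchain (ltnW (ltnW n_ge3))) (starchain (ltnW (ltnW n_ge3)))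
  <-> prime n /\ in_Pi n.
Proof.
rewrite (prime_PiP (ltnW n_ge3) n_odd); split=> [[imp_def _]|gen].
  exact: (signed_pow2_of_imp (ltnW n_ge3) (imp_def MVimp)).
split; last exact: star_definable.
exact: MV_definable (interior_generates_of_signed_pow2 (ltnW n_ge3) _ n_odd gen).
Qed.
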